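(* Let $\mathbb{R}_+=(0,+\infty)$ and let $r$ be a positive integer. The map $\varphi_r: \mathbb{R}_+^4\rightarrow \mathbb{R}_+^4$, $$\varphi_r(x_1,x_2,x_3,x_4)= \left(x_3,\;x_4,\;\frac{x_2^r+x_3^r}{x_1},\; \frac{x_1^rx_4^r+ (x_2^r+x_3^r)^r}{x_1^rx_2}\right),$$ is semiconjugate to the map $\psi: \mathbb{R}_+^2\rightarrow \mathbb{R}_+^2$ given by $$\psi(x,y)=\left(y,\frac{1}{x}\right)$$ by the semiconjugacy $\pi_r: \mathbb{R}_+^4\rightarrow \mathbb{R}_+^2$ defined as $$\pi_r(x_1,x_2,x_3, x_4) =\left(\frac{x_3}{x_2},\frac{x_2^r+x_3^r}{x_1x_4}\right).$$ That is, $\pi_r$ is surjective and $\pi_r\circ\varphi_r=\psi\circ\pi_r$.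
   Context: A map $\varphi$ is semiconjugate to a map $\psi$ by a semiconjugacy $\pi$ if $\pi$ is a surjective (continuous) map with $\pi\circ\varphi=\psi\circ\pi$. *)

(* Defs.v *)
From mathcomp Require Import all_boot all_order all_algebra.
From mathcomp Require Import all_classical all_reals all_analysis.

Set Implicit Arguments.
Unset Strict Implicit.
Unset Printing Implicit Defensive.

Import Order.TTheory GRing.Theory Num.Theory.
Import numFieldNormedType.Exports.

Local Open Scope classical_set_scope.
Local Open Scope ring_scope.

(* Spaces and maps are encoded as subsets A, B of ambient topological spaces
   and total functions on the ambient spaces, of which only the restrictions to
   A and B matter: [phi : A -> A] is semiconjugate to [psi : B -> B] by
   [p : A -> B]. *)
Definition semiconjugacy (X Y : topologicalType) (A : set X) (B : set Y)
    (phi : X -> X) (psi : Y -> Y) (p : X -> Y) : Prop :=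
  [/\ set_fun A A phi /\ set_fun B B psi,
      set_fun A B p,
      {within A, continuous p},
      set_surj A B p
    & {in A, p \o phi =1 psi \o p}].

Section Maps.
Variable R : realType.

Definition Rpos : set R := `]0, +oo[.

Definition Rpos2 : set (R * R) := Rpos `*` Rpos.

Definition Rpos4 : set (R * R * R * R) := Rpos `*` Rpos `*` Rpos `*` Rpos.

Definition phi_map (r : nat) (x : R * R * R * R) : R * R * R * R :=
  let: (x1, x2, x3, x4) := x in
  (x3, x4, (x2 ^+ r + x3 ^+ r) / x1,
   (x1 ^+ r * x4 ^+ r + (x2 ^+ r + x3 ^+ r) ^+ r) / (x1 ^+ r * x2)).

Definition psi_map (z : R * R) : R * R :=
  let: (x, y) := z in (y, 1 / x).

Definition pi_map (r : nat) (x : R * R * R * R) : R * R :=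
  let: (x1, x2, x3, x4) := x in
  (x3 / x2, (x2 ^+ r + x3 ^+ r) / (x1 * x4)).

End Maps.

(* Main.v *)
Require Import Defs.
From mathcomp Require Import all_boot all_order all_algebra.
From mathcomp Require Import all_classical all_reals all_analysis.
From mathcomp Require Import ring.

Import numFieldNormedType.Exports.
Import Order.TTheory GRing.Theory Num.Theory.
Local Open Scope classical_set_scope.
Local Open Scope ring_scope.

(** Put [s = x2 ^+ r + x3 ^+ r] and [y = s / x1]. The last coordinate of [phi_map r x] equals
    [t / x2] with [t = x4 ^+ r + y ^+ r], so both new coordinates come from one exchange rule. The
    numerator in the second coordinate of [pi_map] is then exactly [t], which cancels:
    [pi_map r (phi_map r x)] is [(y / x4, t / (x3 * (t / x2))) = (s / (x1 * x4), x2 / x3)], the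
    image of [pi_map r x] under [psi_map] ([pi_phi_map]). Surjectivity is solved explicitly on the
    slice [x1 = x2 = 1] ([pi_map_surj]). *)

Lemma RposE (R : realType) (x : R) : Rpos x = (0 < x).
Proof. by rewrite /Rpos /= in_itv /= andbT. Qed.

Lemma Rpos4E (R : realType) (x1 x2 x3 x4 : R) :
  Rpos4 (x1, x2, x3, x4) <-> [/\ 0 < x1, 0 < x2, 0 < x3 & 0 < x4].
Proof.
rewrite /Rpos4 /= !RposE.
by split=> [[[[? ?] ?] ?]|[? ? ? ?]]; do ?split.
Qed.

Lemma Rpos2E (R : realType) (x y : R) : Rpos2 (x, y) <-> 0 < x /\ 0 < y.
Proof. by rewrite /Rpos2 /= !RposE. Qed.

Lemma phi_map_pos (R : realType) (r : nat) :
  set_fun (@Rpos4 R) (@Rpos4 R) (@phi_map R r).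
Proof.
move=> [[[x1 x2] x3] x4] /Rpos4E [h1 h2 h3 h4]; apply/Rpos4E.
by split=> //; rewrite ?(divr_gt0, addr_gt0, mulr_gt0, exprn_gt0).
Qed.

Lemma psi_map_pos (R : realType) : set_fun (@Rpos2 R) (@Rpos2 R) (@psi_map R).
Proof.
by move=> [x y] /Rpos2E [hx hy]; apply/Rpos2E; split; rewrite ?divr_gt0.
Qed.

Lemma pi_map_pos (R : realType) (r : nat) :
  set_fun (@Rpos4 R) (@Rpos2 R) (@pi_map R r).
Proof.
move=> [[[x1 x2] x3] x4] /Rpos4E [h1 h2 h3 h4]; apply/Rpos2E.
by split; rewrite ?(divr_gt0, addr_gt0, mulr_gt0, exprn_gt0).
Qed.

(** On the positive orthant no denominator vanishes, so [pi_map] is continuous there even as a map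
    on the whole ambient space; this is stronger than continuity within the subspace. *)
Lemma pi_map_continuous (R : realType) (r : nat) :
  {within @Rpos4 R, continuous (@pi_map R r)}.
Proof.
apply: continuous_in_subspaceT => -[[[x1 x2] x3] x4].
rewrite inE => /Rpos4E [h1 h2 h3 h4].
pose z := (x1, x2, x3, x4).
have c3 : (fun x : R * R * R * R => x.1) @ z --> z.1 by exact: cvg_fst.
have c12 : (fun x : R * R * R * R => x.1.1) @ z --> z.1.1.
  exact: (cvg_comp _ _ c3 cvg_fst).
have p1 : (fun x : R * R * R * R => x.1.1.1) @ z --> x1.
  exact: (cvg_comp _ _ c12 cvg_fst).
have p2 : (fun x : R * R * R * R => x.1.1.2) @ z --> x2.
  exact: (cvg_comp _ _ c12 cvg_snd).
have p3 : (fun x : R * R * R * R => x.1.2) @ z --> x3.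
  exact: (cvg_comp _ _ c3 cvg_snd).
have p4 : (fun x : R * R * R * R => x.2) @ z --> x4 by exact: cvg_snd.
have cX (f : R * R * R * R -> R) (l : R) :
    f @ z --> l -> (fun x => f x ^+ r) @ z --> l ^+ r.
  move=> fl; apply: (cvg_comp f (fun u => u ^+ r) fl).
  exact: exprn_continuous.
have -> : @pi_map R r = fun x => (x.1.2 / x.1.1.2,
    (x.1.1.2 ^+ r + x.1.2 ^+ r) / (x.1.1.1 * x.2)).
  by apply/funext => -[[[]]].
have c1 : (fun x : R * R * R * R => x.1.2 / x.1.1.2) @ z --> x3 / x2.
  by apply: cvgM => //; apply: cvgV => //; rewrite gt_eqF.
have c2 : (fun x : R * R * R * R =>
    (x.1.1.2 ^+ r + x.1.2 ^+ r) / (x.1.1.1 * x.2)) @ z -->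
    (x2 ^+ r + x3 ^+ r) / (x1 * x4).
  apply: cvgM; first by apply: cvgD; exact: cX.
  by apply: cvgV; [rewrite gt_eqF ?mulr_gt0|exact: cvgM].
exact: (cvg_pair c1 c2).
Qed.

Lemma pi_map_surj (R : realType) (r : nat) :
  set_surj (@Rpos4 R) (@Rpos2 R) (@pi_map R r).
Proof.
move=> [a b] /Rpos2E [ha hb].
have hs : 0 < 1 + a ^+ r by rewrite addr_gt0 ?exprn_gt0.
(* With [x1 = x2 = 1], the first coordinate forces [x3 = a], and [(1 + a ^+ r) / x4 = b] then
   determines [x4]. *)
exists (1, 1, a, (1 + a ^+ r) / b); first by apply/Rpos4E; rewrite divr_gt0.
rewrite /= expr1n divr1 mul1r; congr pair.
by rewrite invf_div mulrCA divff ?mulr1 // gt_eqF.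
Qed.

(* The last coordinate of [phi_map r x] is [(x4 ^+ r + y ^+ r) / x2], where [y]
   is its third one. *)
Lemma pi_phi_map (R : realType) (r : nat) (x : R * R * R * R) :
  Rpos4 x -> pi_map r (phi_map r x) = psi_map (pi_map r x).
Proof.
case: x => [[[x1 x2] x3] x4] /Rpos4E [h1 h2 h3 h4] /=.
set s := x2 ^+ r + x3 ^+ r.
congr pair; first by rewrite invfM mulrA.
have x1r_neq0 : x1 ^+ r != 0 by rewrite gt_eqF ?exprn_gt0.
have -> : (x1 ^+ r * x4 ^+ r + s ^+ r) / (x1 ^+ r * x2) =
    (x4 ^+ r + (s / x1) ^+ r) / x2.
  by rewrite expr_div_n; field; rewrite x1r_neq0 gt_eqF.
(* Once this sum is abstracted as a nonzero [t], the goal is [t / (x3 * (t / x2)) = 1 / (x3 / x2)],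
   free of powers. *)
have : x4 ^+ r + (s / x1) ^+ r != 0.
  by rewrite gt_eqF // ?(addr_gt0, exprn_gt0, divr_gt0).
set t := x4 ^+ r + _ => t_neq0.
by field; rewrite t_neq0 !gt_eqF.
Qed.

Theorem proposition1 (R : realType) (r : nat) (hr : (0 < r)%N) :
  semiconjugacy (@Rpos4 R) (@Rpos2 R) (@phi_map R r) (@psi_map R) (@pi_map R r).
Proof.
split.
- by split; [exact: phi_map_pos|exact: psi_map_pos].
- exact: pi_map_pos.
- exact: pi_map_continuous.
- exact: pi_map_surj.
- by move=> x; rewrite inE; exact: pi_phi_map.
Qed.
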